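(* Let $d,k$ be integers with $1\le k\le d$, and let $1\le l< S(d,k)$. Then the puzzle graph $puz[d,k,l]$ contains only $k$-isolated or $k$-semi-isolated configurations.
   Context: Let $d\ge 1$, $1\le k\le d$, $1\le l\le 2^d$ be integers. $Q^d$ is the graph of vertices and edges of the $d$-dimensional cube, with vertex set $\{0,1\}^d$. A $k$-dimensional face ($k$-face) of $Q^d$ is a set of $2^k$ vertices obtained by fixing $d-k$ of the coordinates. $\mathcal{C}[d,l]$ is the set of all configurations of $2^d-l$ tokens, labeled $1,\dots,2^d-l$, placed on distinct vertices of $Q^d$ (so $l$ vertices are unoccupied). For a configuration $C$, $\mathcal L_C=\{1,\dots,2^d-l\}$ is its set of labels (tokens). Moves: if a token $t$ sits at a vertex of a $k$-face $\sigma$ and all remaining vertices of $\sigma$ are unoccupied, then $t$ can be moved to any other vertex of $\sigma$; this is called a $k$-move. The puzzle graph $puz[d,k,l]$ has vertex set $\mathcal{C}[d,l]$, with $C$ and $D$ joined by an edge when one is reached from the other by a single $k$-move. A configuration $C$ is $k$-isolated if no token can perform a $k$-move; it is $k$-semi-isolated if there is a non-empty proper subset $\mathcal A_C\subsetneq\mathcal L_C$ such that every configuration in the connected component of $C$ in $puz[d,k,l]$ is obtained from $C$ by a series of $k$-moves affecting only tokens in $\mathcal L_C\setminus\mathcal A_C$. A configuration is obtained from $C$ by a permutation $g$ if it has the same occupied vertices and the labels are permuted by $g$. $puz[d,k,l]$ has the even solvability property if there is a configuration $C\in\mathcal C[d,l]$ such that all configurations obtained from $C$ by an even permutation of the labels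 lie in the same connected component of $puz[d,k,l]$ as $C$. $S(d,k)$ is the minimum integer $l$ such that $puz[d,k,l]$ has the even solvability property; for $d=k$ the value is taken to be $S(k,k)=2^k-1$. *)

(* Defs.v *)
From HB Require Import structures.
From mathcomp Require Import all_boot all_fingroup.

Set Implicit Arguments.
Unset Strict Implicit.
Unset Printing Implicit Defensive.

Notation cube d := {ffun 'I_d -> bool}.

(* The coordinates in [S] are fixed to their values at [v]. *)
Definition face_at d (S : {set 'I_d}) (v : cube d) : {set cube d} :=
  [set x : cube d | [forall i in S, x i == v i]].

Definition is_face d (k : nat) (sigma : {set cube d}) : bool :=
  [exists S : {set 'I_d}, exists v : cube d,
     (#|S| == d - k) && (sigma == face_at S v)].

(* The labels 1, ..., 2^d - l are represented by 'I_(2 ^ d - l); a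
   configuration sends each label to the vertex occupied by its token. *)
Notation label d l := 'I_(2 ^ d - l).

Record config (d l : nat) : Type := Config {
  position :> {ffun label d l -> cube d};
  _ : injectiveb position
}.

HB.instance Definition _ d l := [isSub for @position d l].
HB.instance Definition _ d l := [Finite of config d l by <:].

Definition occupied d l (C : config d l) : {set cube d} := [set C t | t : label d l].

Definition kmove d l (k : nat) (t : label d l) (C D : config d l) : bool :=
  [exists sigma : {set cube d},
     [&& is_face k sigma,
         C t \in sigma,
         [forall v in sigma :\ C t, v \notin occupied C],
         D t \in sigma :\ C t
       & [forall s : label d l, (s != t) ==> (D s == C s)]]].

(* Moves are reversible (kmove_sym below), so [puz] is an undirected graph
   and [connect] describes its connected components. *)
Definition puz d l (k : nat) : rel (config d l) :=
  fun C D => [exists t : label d l, kmove k t C D].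

Definition isolated d l (k : nat) (C : config d l) : Prop :=
  ~ exists (t : label d l) (D : config d l), kmove k t C D.

Definition puz_avoiding d l (k : nat) (A : {set label d l}) : rel (config d l) :=
  fun C D => [exists t in ~: A, kmove k t C D].

Definition semi_isolated d l (k : nat) (C : config d l) : Prop :=
  exists A : {set label d l},
    [/\ A != set0, A \proper [set: label d l]
      & forall D : config d l,
          connect (puz k) C D -> connect (puz_avoiding k A) C D].

(* [D] carries the label [g t] where [C] carries [t]. *)
Definition obtained_by d l (g : {perm label d l}) (C D : config d l) : bool :=
  [forall t : label d l, D (g t) == C t].

Definition even_solvable (d k l : nat) : bool :=
  [exists C : config d l, forall g : {perm label d l}, forall D : config d l,
     ~~ odd_perm g && obtained_by g C D ==> connect (puz k) C D].

Definition even_solvable_in_range (d k l : nat) : bool :=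
  (1 <= l <= 2 ^ d) && even_solvable d k l.

Lemma even_solvable_exists (d k : nat) : exists l, even_solvable_in_range d k l.
Proof.
exists (2 ^ d).
rewrite /even_solvable_in_range expn_gt0 leqnn /=.
have no_label : label d (2 ^ d) -> False by rewrite subnn => -[].
have injC : injectiveb [ffun _ : label d (2 ^ d) => [ffun _ => false] : cube d].
  by apply/injectiveP => t; case: (no_label t).
apply/existsP; exists (Config injC).
apply/forallP => g; apply/forallP => D; apply/implyP => _.
suff -> : D = Config injC by exact: connect0.
by apply/val_inj/ffunP => t; case: (no_label t).
Qed.

(* The value 2^k - 1 for d = k is a convention, not the minimum: with two
   tokens no move is possible when d = k, but the alternating group is trivial,
   so the even solvability property already holds for l = 2^k - 2 >= 1. *)
Definition S_min (d k : nat) : nat :=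
  if d == k then 2 ^ k - 1 else ex_minn (even_solvable_exists d k).

Lemma kmove_sym d l k (t : label d l) (C D : config d l) :
  kmove k t C D -> kmove k t D C.
Proof.
case/existsP => sigma /and5P[fs Cs /forallP emp].
rewrite in_setD1 => /andP[neq Ds] /forallP fixed.
apply/existsP; exists sigma; apply/and5P; split=> //.
- apply/forallP => v; apply/implyP; rewrite in_setD1 => /andP[vD vs].
  apply/imsetP => -[s _ def_v].
  have st : s != t by apply: contraNneq vD => <-; rewrite def_v.
  have Ds_eq := eqP (implyP (fixed s) st).
  have vC : v != C t.
    rewrite def_v Ds_eq; apply: contraNneq st => eqC.
    by apply/eqP/(injectiveP _ (valP C)).
  have := implyP (emp v); rewrite in_setD1 vC vs => /(_ isT) /negP; apply.
  by apply/imsetP; exists s; rewrite // def_v Ds_eq.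
- by rewrite in_setD1 eq_sym neq Cs.
- apply/forallP => s; apply/implyP => st.
  by rewrite eq_sym (implyP (fixed s) st).
Qed.

(* Main.v *)
Require Import Defs.
From mathcomp Require Import all_boot all_fingroup all_algebra.

(** Put [r = d - k] and let [b] be the size of a Hamming ball of radius [r];
    then [S(d,k) <= 2 ^ d - b], so [l < S(d,k)] leaves more than [b] tokens.

    With more than [b] tokens, the evaluations of the multilinear monomials of
    degree at most [r] at the positions of the tokens satisfy a nontrivial
    linear dependency over the tokens.  The indicator function of a [k]-face is
    a polynomial of degree [r], so a token alone in a [k]-face has coefficient
    [0]; hence the dependency survives every move, and a token with nonzero
    coefficient never moves.

    With exactly [b] tokens and [k < d], let the tokens fill the ball of radius
    [r] about [c].  A token at distance [r] from [c] can leave the ball, and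
    flipping the coordinate [i] of all such tokens that agree with [c] at [i]
    turns the ball about [c] into the ball about [flip i c].  The same works
    inside the subcube of the points differing from [c] on a set [w]; when
    [#|w| = r - 1], the commutator of two such reflections is a 3-cycle on the
    tokens [c + w], [c + w + i], [c + w + j].  These 3-cycles connect the two
    outer layers of the ball, and reflecting the ball brings every token into
    an outer layer, so all even permutations are reached. *)

Set Implicit Arguments.
Unset Strict Implicit.
Unset Printing Implicit Defensive.

(** * Groups generated by 3-cycles *)

Section ThreeCycles.
Variable T : finType.
Local Open Scope group_scope.

Definition cycle3 (a b c : T) : {perm T} := tperm a b * tperm a c.

Lemma cycle3_rot a b c : a != b -> a != c -> b != c -> cycle3 a b c = cycle3 b c a.
Proof.
move=> ab ac bc; rewrite /cycle3.
have -> : tperm b c = tperm a c ^ tperm a b.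
  by rewrite tpermJ tpermL tpermD // eq_sym.
by rewrite conjgE tpermV (tpermC b a) -!mulgA tperm2 mulg1.
Qed.

Lemma perm_on_cycle3 (X : {set T}) a b c :
  a \in X -> b \in X -> c \in X -> perm_on X (cycle3 a b c).
Proof.
move=> aX bX cX; apply: perm_onM; apply/subsetP => x; rewrite inE;
  by case: tpermP => [->|->|]; rewrite ?eqxx.
Qed.

Lemma even_cycle3 a b c : a != b -> a != c -> odd_perm (cycle3 a b c) = false.
Proof. by move=> ab ac; rewrite odd_permM !odd_tperm ab ac. Qed.

Lemma perm_on_stable (X : {set T}) y (g : {perm T}) :
  perm_on (y |: X) g -> g y = y -> perm_on X g.
Proof.
move=> gX gy; apply/subsetP => x; rewrite inE => gx.
have /setU1P[xy|//] := subsetP gX x gx.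
by rewrite xy gy eqxx in gx.
Qed.

Variable G : {group {perm T}}.

Definition alt_in (X : {set T}) :=
  [forall g : {perm T}, perm_on X g && ~~ odd_perm g ==> (g \in G)].

Lemma alt_inP X :
  reflect (forall g, perm_on X g -> ~~ odd_perm g -> g \in G) (alt_in X).
Proof.
apply: (iffP forallP) => H g; last by apply/implyP => /andP[]; apply: H.
by move=> gX gE; apply: (implyP (H g)); rewrite gX.
Qed.

(** The alternating group on two points is trivial; this starts the growth of [X] below. *)
Lemma alt_in2 a b : alt_in [set a; b].
Proof.
apply/alt_inP => g gX gE.
have fix_a h : perm_on [set a; b] h -> h a = a -> h = 1.
  move=> hX ha; have hb := perm_on_stable hX ha.
  apply/permP => x; rewrite perm1.
  case: (x =P b) => [->|/eqP xb]; last by rewrite (out_perm hb) // inE.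
  by have := perm_closed b hb; rewrite !inE eqxx => /eqP.
case: (g a =P a) => [/(fix_a _ gX)-> //|/eqP ga].
have gab : g a = b.
  have := perm_closed a gX; rewrite !inE eqxx (negPf ga) => /eqP //.
have : g * tperm a b = 1.
  apply: fix_a; last by rewrite permM gab tpermR.
  apply: perm_onM => //; apply/subsetP => x; rewrite !inE.
  by case: tpermP => [->|->|]; rewrite ?eqxx ?orbT.
move/(congr1 (@odd_perm T)); rewrite odd_permM odd_tperm odd_perm1 (negPf gE).
by rewrite -gab eq_sym ga.
Qed.

(** For an even [h] on [y |: X], some even [m] in [G] sends [h y] back to [y]; then [h * m] is an
    even permutation of [X]. The 3-cycle [z], or [z * z], or [z] after a 3-cycle of [X], provides
    [m]. *)
Lemma alt_in_grow (X : {set T}) x x' y :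
    alt_in X -> x \in X -> x' \in X -> x != x' -> y \notin X ->
  cycle3 x x' y \in G -> alt_in (y |: X).
Proof.
move=> /alt_inP altX xX x'X xx' yX zG; apply/alt_inP => h hX hE.
have xy : x != y by apply: contraNneq yX => <-.
have x'y : x' != y by apply: contraNneq yX => <-.
have sub : X \subset y |: X by apply: subsetUr.
have subP := fun u => subsetP sub u.
set z := cycle3 x x' y in zG.
have zX : perm_on (y |: X) z by apply: perm_on_cycle3; rewrite ?setU11 ?subP.
have zE : odd_perm z = false by apply: even_cycle3.
have zx : z x = x' by rewrite permM tpermL tpermD // eq_sym.
have zx' : z x' = y by rewrite permM tpermR tpermL.
suff [m [mG mX mE my]] : exists m,
    [/\ m \in G, perm_on (y |: X) m, ~~ odd_perm m & m (h y) = y].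
  rewrite -(groupMr _ mG); apply: altX; last by rewrite odd_permM (negPf hE) (negPf mE).
  by apply: (@perm_on_stable _ y); rewrite ?permM //; apply: perm_onM.
case: (h y =P y) => [->|/eqP hy].
  by exists 1; rewrite group1 perm_on1 odd_perm1 perm1.
case: (h y =P x) => [->|/eqP hx].
  exists (z * z); rewrite groupM // perm_onM // odd_permM zE permM zx zx'.
  by [].
case: (h y =P x') => [->|/eqP hx']; first by exists z; rewrite zE.
have hyX : h y \in X.
  by have := perm_closed y hX; rewrite setU11 => /setU1P[e|//]; rewrite e eqxx in hy.
have mX := perm_on_cycle3 hyX x'X xX.
have mE : odd_perm (cycle3 (h y) x' x) = false by apply: even_cycle3.
have mG : cycle3 (h y) x' x \in G by apply: altX; rewrite ?mE.
exists (cycle3 (h y) x' x * z); split.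
- exact: groupM.
- by apply: perm_onM => //; apply: subset_trans mX sub.
- by rewrite odd_permM mE zE.
- by rewrite permM [X in z X]permM tpermL tpermD ?zx'.
Qed.

(** A maximal [X] containing [a], [b], [c] works: a 3-cycle of [G] with exactly two points in [X]
    would enlarge it, and one with a single point in [X] yields by conjugation one with two. *)
Lemma alt_in_closed a b c :
    a != b -> a != c -> b != c -> cycle3 a b c \in G ->
  exists X : {set T}, [/\ a \in X, alt_in X &
    forall x y z, x != y -> x != z -> y != z -> cycle3 x y z \in G ->
      x \in X -> (y \in X) && (z \in X)].
Proof.
move=> ab ac bc abcG.
pose P (X : {set T}) := [&& alt_in X, a \in X, b \in X & c \in X].
have PX : P (c |: [set a; b]).
  rewrite /P !inE !eqxx ?orbT /= andbT.
  apply: (alt_in_grow (alt_in2 a b)) ab _ abcG; rewrite !inE ?eqxx ?orbT //.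
  by rewrite negb_or ![c == _]eq_sym ac bc.
case: (maxset_exists PX) => X /maxsetP[/and4P[altX aX bX cX] maxX] _.
exists X; split=> // x y z xy xz yz xyzG xX.
have grow u v w : u \in X -> v \in X -> u != v -> cycle3 u v w \in G -> w \in X.
  move=> uX vX uv uvwG; apply: contraT => wX.
  suff wXE : w |: X = X by rewrite -wXE setU11 in wX.
  apply: maxX (subsetUr _ _); rewrite /P !inE aX bX cX !orbT !andbT.
  exact: alt_in_grow altX uX vX uv wX uvwG.
suff yX : y \in X by rewrite yX (grow x y z).
apply: wlog_neg => yX.
case: (boolP (z \in X)) => zX.
  apply: (grow z x y) => //; first by rewrite eq_sym.
  by rewrite -2?cycle3_rot // eq_sym.
(* Conjugating a 3-cycle [(u v x)] of [Alt(X)] by [(x y z)] gives [(u v y)]. *)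
have [u [v [uX vX uv ux vx]]] : exists u v, [/\ u \in X, v \in X, u != v, u != x & v != x].
  case: (a =P x) => [<-|/eqP ax]; first by exists b, c; rewrite bX cX bc ![_ == a]eq_sym ab ac.
  case: (b =P x) => [<-|/eqP bx]; first by exists a, c; rewrite aX cX ac ab eq_sym bc.
  by exists a, b.
have uy : u != y by apply: contraNneq yX => <-.
have uz : u != z by apply: contraNneq zX => <-.
have vy : v != y by apply: contraNneq yX => <-.
have vz : v != z by apply: contraNneq zX => <-.
apply: (grow u v y) => //.
have -> : cycle3 u v y = cycle3 u v x ^ cycle3 x y z.
  rewrite /cycle3 conjMg !conjgM !tpermJ.
  by rewrite tpermL !tpermD // 1?eq_sym // 1?eq_sym.
rewrite groupJ //; apply: (alt_inP _ altX); first exact: perm_on_cycle3.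
by rewrite even_cycle3.
Qed.

End ThreeCycles.

(** * A token that never moves *)

Section FrozenToken.
Import GRing.Theory.
Local Open Scope ring_scope.
Variables d k l : nat.

(** Since coordinates take the values 0 and 1, exponents are irrelevant and a monomial is given by
    its set of variables. *)
Definition monomial (A : {set 'I_d}) (x : cube d) : bool := [forall i in A, x i].

Definition dependency (c : label d l -> rat) (C : config d l) : Prop :=
  forall A : {set 'I_d}, (#|A| <= d - k)%N -> \sum_t c t * (monomial A (C t))%:R = 0.

Lemma dependency_face c C (S : {set 'I_d}) v :
  dependency c C -> (#|S| <= d - k)%N -> \sum_t c t * (C t \in face_at S v)%:R = 0.
Proof.
move=> dep leS.
(* The face indicator is a product of factors [x a] or [1 - x a]. The induction turns these factors
   one by one into variables of [A]. *)
suff gen (n : nat) (S' A : {set 'I_d}) : #|S'| = n -> (#|S'| + #|A| <= d - k)%N ->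
    \sum_t c t * ((C t \in face_at S' v) && monomial A (C t))%:R = 0.
  have := gen #|S| S set0 erefl; rewrite cards0 addn0 => /(_ leS) eq0.
  rewrite -[RHS]eq0; apply: eq_bigr => t _; congr (_ * _%:R).
  rewrite [monomial _ _](_ : _ = true) ?andbT //.
  by apply/forallP => i; rewrite inE.
elim: n S' A => [|n IHn] S' A.
  move/eqP; rewrite cards_eq0 => /eqP->; rewrite cards0 add0n => /dep eq0.
  rewrite -[RHS]eq0; apply: eq_bigr => t _; congr (_ * _%:R).
  rewrite inE [X in X && _](_ : _ = true) //.
  by apply/forallP => i; rewrite inE.
move=> cardS leSA.
have [a aS] : exists a, a \in S' by apply/set0Pn; rewrite -card_gt0 cardS.
have cardD : #|S' :\ a| = n by move: cardS; rewrite (cardsD1 a) aS => -[].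
have faceE x : (x \in face_at S' v) = (x a == v a) && (x \in face_at (S' :\ a) v).
  rewrite !inE; apply/forallP/andP => [H|[xa /forallP H] i].
    split; first exact: (implyP (H a)).
    by apply/forallP => i; apply/implyP; rewrite inE => /andP[_ iS]; apply: (implyP (H i)).
  apply/implyP => iS; case: (i =P a) => [->//|/eqP ia].
  by apply: (implyP (H i)); rewrite !inE ia.
have monoE x : monomial (a |: A) x = x a && monomial A x.
  apply/forallP/andP => [H|[xa /forallP H] i].
    split; first by apply: (implyP (H a)); rewrite setU11.
    by apply/forallP => i; apply/implyP => iA; apply: (implyP (H i)); rewrite inE iA orbT.
  by apply/implyP => /setU1P[->//|]; apply/implyP.
have leA : (#|a |: A| <= 1 + #|A|)%N by rewrite cardsU1 leq_add2r leq_b1.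
have IH1 : \sum_t c t * ((C t \in face_at (S' :\ a) v) && monomial (a |: A) (C t))%:R = 0.
  apply: IHn => //; apply: leq_trans leSA; rewrite cardD cardS addSnnS leq_add2l.
  exact: leA.
have IH2 : \sum_t c t * ((C t \in face_at (S' :\ a) v) && monomial A (C t))%:R = 0.
  by apply: IHn => //; apply: leq_trans leSA; rewrite cardD cardS leq_add2r.
(* If [v a] holds, the factor is [x a] and joins the monomial; otherwise it is [1 - x a], which
   gives the difference of [IH2] and [IH1]. *)
case va: (v a).
  rewrite -[RHS]IH1; apply: eq_bigr => t _; rewrite faceE monoE va eqb_id.
  by case: (C t a); rewrite /= ?andbF.
rewrite -[RHS](subrr 0) -[X in X - _]IH2 -[X in _ - X]IH1 -sumrB; apply: eq_bigr => t _.
rewrite -mulrBr faceE monoE va; congr (_ * _).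
by case: (C t a); case: (_ \in _); case: (monomial A _); rewrite /= ?subrr ?subr0.
Qed.

Lemma kmove_dependency c C D t : dependency c C -> kmove k t C D -> c t = 0 /\ dependency c D.
Proof.
move=> dep /existsP[sigma /and5P[/existsP[S /existsP[v /andP[/eqP cS /eqP->]]]]].
move=> Ct /forallP emp _ /forallP fixed.
have ct : c t = 0.
  have := dependency_face v dep; move/(_ S); rewrite cS => /(_ (leqnn _)).
  rewrite (bigD1 t) //= Ct mulr1 big1 ?addr0 // => s st.
  suff -> : (C s \in face_at S v) = false by rewrite mulr0.
  apply: contraTF isT => Cs; have := implyP (emp (C s)); rewrite in_setD1 Cs andbT.
  have neq : C s != C t by apply: contraNneq st => /(injectiveP _ (valP C))->.
  by move=> /(_ neq) /negP; case; apply/imsetP; exists s.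
split=> // A leA; rewrite -[RHS](dep A leA); apply: eq_bigr => s _.
by case: (s =P t) => [->|/eqP st]; rewrite ?ct ?mul0r // (eqP (implyP (fixed s) st)).
Qed.

Lemma dependency_exists (C : config d l) :
  (#|[set A : {set 'I_d} | #|A| <= d - k]| < 2 ^ d - l)%N ->
  exists2 c, dependency c C & exists t, c t != 0.
Proof.
set B := [set A | _] => ltB.
pose M : 'M[rat]_(2 ^ d - l, #|B|) := \matrix_(t, a) (monomial (enum_val a) (C t))%:R.
(* [M] has more rows (tokens) than columns (monomials), so its left kernel is nonzero. *)
have : kermx M != 0.
  by rewrite -mxrank_eq0 mxrank_ker subn_eq0 -ltnNge (leq_ltn_trans (rank_leq_col M)).
case/rowV0Pn => u /sub_kermxP uM u0; exists (u 0).
  move=> A leA; have AB : A \in B by rewrite inE.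
  have := congr1 (fun N : 'rV_ _ => N 0 (enum_rank_in AB A)) uM; rewrite !mxE => eq0.
  by rewrite -[RHS]eq0; apply: eq_bigr => t _; rewrite !mxE enum_rankK_in.
apply/existsP; apply: contraNT u0 => /existsPn H; apply/eqP/rowP => t; rewrite mxE.
by apply/eqP; have := H t; rewrite negbK.
Qed.

Lemma isolated_or_semi_isolated (C : config d l) :
  (#|[set A : {set 'I_d} | #|A| <= d - k]| < 2 ^ d - l)%N ->
  isolated k C \/ semi_isolated k C.
Proof.
move/dependency_exists => /(_ C) [c dep [t0 ct0]].
case: (boolP [exists t, exists D : config d l, kmove k t C D]); last first.
  move=> no; left => -[t [D tD]]; case/negP: no; apply/existsP; exists t.
  by apply/existsP; exists D.
case/existsP => t1 /existsP[D1 /(kmove_dependency dep) [ct1 _]].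
(* [[set t0]] is a proper subset because the movable token [t1] has coefficient 0 and thus differs
   from [t0]. *)
right; exists [set t0]; split.
- by apply/set0Pn; exists t0; rewrite inE.
- rewrite properT; apply: contraTneq ct0 => eqT; rewrite negbK -ct1.
  by suff /set1P-> : t1 \in [set t0] by []; rewrite eqT inE.
move=> D /connectP[p]; elim: p C dep => [|E p IHp] C depC /=; first by move=> _ ->.
case/andP => /existsP[t tCE] pE Dlast; have [ct depE] := kmove_dependency depC tCE.
apply: connect_trans (IHp E depE pE Dlast); apply: connect1.
apply/existsP; exists t; rewrite tCE andbT !inE.
by apply: contraNneq ct0 => <-; rewrite ct.
Qed.

End FrozenToken.

(** * Reflections of Hamming balls *)

Section Cube.
Variable d : nat.
Implicit Types (x c : cube d) (i j : 'I_d) (w : {set 'I_d}).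

(** This identifies vertices with subsets of the coordinates, [c] being the empty set; the
    cardinality is the Hamming distance to [c]. *)
Definition diffs x c : {set 'I_d} := [set i | x i != c i].

Definition flip i x : cube d := [ffun j => x j (+) (j == i)].

Lemma flipK i : involutive (flip i).
Proof. by move=> x; apply/ffunP => j; rewrite !ffunE -addbA addbb addbF. Qed.

Lemma flipC i j x : flip i (flip j x) = flip j (flip i x).
Proof. by apply/ffunP => a; rewrite !ffunE addbAC. Qed.

Lemma in_diffs_flip i j x c : (j \in diffs (flip i x) c) = (j \in diffs x c) (+) (j == i).
Proof. by rewrite !inE !ffunE; case: (x j); case: (c j); case: (j == i). Qed.

Lemma diffs_flipC i x c : diffs x (flip i c) = diffs (flip i x) c.
Proof. by apply/setP => j; rewrite !inE !ffunE; case: (x j); case: (c j); case: (j == i). Qed.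

Lemma diffs_inj c : injective (diffs^~ c).
Proof.
move=> x y e; apply/ffunP => i; have := congr1 (fun A : {set _} => i \in A) e.
by rewrite !inE; case: (x i); case: (y i); case: (c i).
Qed.

Lemma subset_diffs_flip w i x c :
  i \notin w -> (w \subset diffs (flip i x) c) = (w \subset diffs x c).
Proof.
move=> iw; apply/subsetP/subsetP => sub j jw; have := sub j jw;
  by rewrite in_diffs_flip (_ : (j == i) = false) ?addbF //;
     apply: contraNF iw => /eqP <-.
Qed.

Lemma card_diffs_flip i x c :
  #|diffs (flip i x) c| = if i \in diffs x c then #|diffs x c|.-1 else #|diffs x c|.+1.
Proof.
have eqD : diffs (flip i x) c :\ i = diffs x c :\ i.
  by apply/setP => j; rewrite !in_setD1 in_diffs_flip; case: (j == i); rewrite ?addbF.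
rewrite [LHS](cardsD1 i) [#|diffs x c|](cardsD1 i) eqD in_diffs_flip eqxx addbT.
by case: (i \in diffs x c).
Qed.

End Cube.

(** * Reflections of balls realised by moves *)

Section Moves.
Variables d k l : nat.
Implicit Types (C D : config d l) (t : label d l) (c x : cube d) (w : {set 'I_d}).

Lemma config_inj C : injective C.
Proof. by apply/injectiveP; exact: (valP C). Qed.

Lemma face_at_refl (S : {set 'I_d}) x : x \in face_at S x.
Proof. by rewrite inE; apply/forallP => i; rewrite eqxx implybT. Qed.

(* No token other than [t] starts or ends in the face used by [t], so the moves
   can be performed one by one in any order. *)
Lemma parallel_moves C (f : label d l -> cube d) :
    (forall t, C t != f t -> exists S : {set 'I_d},
       [/\ #|S| = d - k, f t \in face_at S (C t)
         & forall s, s != t -> (C s \notin face_at S (C t)) && (f s \notin face_at S (C t))]) ->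
  exists2 D : config d l, D =1 f & connect (puz k) C D.
Proof.
have [n] := ubnP #|[set t | C t != f t]|; elim: n C => // n IHn C.
case: (pickP (fun t => C t != f t)) => [t Cft|eqC _ _]; last first.
  by exists C => // t; apply/eqP; have := eqC t; move/negbFE.
rewrite ltnS => leC far; have [S [cS ftS avoid]] := far t Cft.
pose g : {ffun label d l -> cube d} := [ffun s => if s == t then f t else C s].
have g_inj : injectiveb g.
  apply/injectiveP => a b; rewrite !ffunE.
  case: (a =P t) => [->|/eqP at_]; case: (b =P t) => [->|/eqP bt] //.
  - by move=> e; have /andP[] := avoid b bt; rewrite -e ftS.
  - by move=> e; have /andP[] := avoid a at_; rewrite e ftS.
  - exact: config_inj.
pose E := Config g_inj.
have Et : E t = f t by rewrite /= ffunE eqxx.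
have Es s : s != t -> E s = C s by move=> st; rewrite /= ffunE (negPf st).
have CE : connect (puz k) C E.
  apply: connect1; apply/existsP; exists t; apply/existsP; exists (face_at S (C t)).
  apply/and5P; split.
  - by apply/existsP; exists S; apply/existsP; exists (C t); rewrite cS !eqxx.
  - exact: face_at_refl.
  - apply/forallP => v; apply/implyP; rewrite in_setD1 => /andP[vC vS].
    apply/imsetP => -[s _ vE]; rewrite vE in vC vS.
    have st : s != t by apply: contraNneq vC => ->.
    by have /andP[/negP] := avoid s st.
  - by rewrite in_setD1 Et ftS eq_sym Cft.
  - by apply/forallP => s; apply/implyP => /Es ->.
have [|s Efs|D Df ED] := IHn E; last by exists D => //; apply: connect_trans CE ED.
  apply: leq_trans leC; apply: proper_card; apply/properP; split.
    apply/subsetP => s; rewrite !inE; case: (s =P t) => [->|/eqP/Es -> //].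
    by rewrite Et eqxx.
  by exists t; rewrite inE // Et eqxx.
(* The hypothesis passes to [E]: token [t] now sits at [f t], which avoids the faces of the other
   moving tokens as well. *)
have st : s != t by apply: contraNneq Efs => ->; rewrite Et.
rewrite Es // in Efs *; have [S' [cS' fsS' avoid']] := far s Efs; exists S'; split=> // a as_.
have /andP[Ca fa] := avoid' a as_; rewrite fa andbT.
by case: (a =P t) => [e|/eqP/Es -> //]; rewrite e Et -e.
Qed.

Local Notation r := (d - k).

(* In the subcube of the points that differ from [c] on all of [w], the
   occupied vertices are those at Hamming distance at most [d - k] from [c]. *)
Definition local_ball c w C : Prop :=
  forall x, w \subset diffs x c -> (x \in occupied C) = (#|diffs x c| <= r).

(** Only these points of the ball about [c] are farther than [r] from [flip i c], namely at distance
    [r + 1]; all others keep their place. *)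
Definition reflect_on c w i x : cube d :=
  if [&& w \subset diffs x c, #|diffs x c| == r & i \notin diffs x c] then flip i x else x.

Lemma occupied_token C t : C t \in occupied C.
Proof. exact: imset_f. Qed.

Lemma reflect_config c w i C : local_ball c w C -> i \notin w ->
  exists D : config d l, [/\ connect (puz k) C D, (forall t, D t = reflect_on c w i (C t))
    & local_ball (flip i c) w D].
Proof.
move=> ballC iw.
have leC t : w \subset diffs (C t) c -> #|diffs (C t) c| <= r.
  by move=> sub; rewrite -ballC // occupied_token.
have faceE x y : (y \in face_at (diffs x c) x) = (diffs x c \subset diffs y c).
  rewrite inE; apply/forallP/subsetP => [H a aD|H a].
    have := implyP (H a) aD; rewrite !inE in aD * => /eqP ->; exact: aD.
  apply/implyP => aD; have := H a aD; rewrite !inE in aD *.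
  by case: (y a) (x a) (c a) aD => [] [] [].
case: (@parallel_moves C (fun t => reflect_on c w i (C t))).
  move=> t; rewrite /reflect_on; case: ifP; last by rewrite eqxx.
  (* The face fixes the [r] coordinates where [C t] differs from [c]. Every other point of it is
     farther than [r] from [c], hence free, and [flip i] stays inside since [i] is not fixed. *)
  case/and3P => sub /eqP card_r iD _; exists (diffs (C t) c).
  have out s : s != t -> ~~ (diffs (C t) c \subset diffs (C s) c).
    move=> st; apply: contra st => sub'.
    have le := leC s (subset_trans sub sub').
    have /eqP e : diffs (C t) c == diffs (C s) c by rewrite eqEcard sub' card_r.
    by rewrite (config_inj (diffs_inj e)).
  split=> // [|s st].
    by rewrite faceE subset_diffs_flip.
  rewrite !faceE out //=; case: ifP => _; last exact: out.
  by rewrite subset_diffs_flip // out.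
move=> D DE CD; exists D; split=> // y; rewrite diffs_flipC subset_diffs_flip // => wy.
have occD : y \in occupied D <->
    (y \in occupied C) && ~~ ((#|diffs y c| == r) && (i \notin diffs y c)) \/
    [&& flip i y \in occupied C, #|diffs (flip i y) c| == r & i \notin diffs (flip i y) c].
  split.
    case/imsetP => t _ yE; rewrite yE DE /reflect_on in wy *.
    case: ifP => [/and3P[_ Dr iD]|/negbT neg].
      by right; rewrite flipK occupied_token Dr.
    have [sub|nsub] := boolP (w \subset diffs (C t) c).
      by left; rewrite occupied_token /=; rewrite sub in neg.
    by rewrite (negPf nsub) /= (negPf nsub) in wy.
  case.
    case/andP => /imsetP[t _ e] neg; apply/imsetP; exists t => //.
    by rewrite DE /reflect_on -e wy /= (negPf neg).
  case/and3P => /imsetP[t _ e] Dr iD; apply/imsetP; exists t => //.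
  by rewrite DE /reflect_on -e Dr iD subset_diffs_flip // wy flipK.
apply/idP/idP; rewrite card_diffs_flip.
  case/occD.
    rewrite ballC // => /andP[le]; case: ifP => iD.
      by move=> _; apply: leq_trans le; exact: leq_pred.
    by rewrite andbT => neq; rewrite ltn_neqAle neq.
  rewrite in_diffs_flip eqxx addbT negbK card_diffs_flip => /and3P[_]; case: ifP => // _.
  by move/eqP->.
move=> le; apply/occD; move: le; case: ifP => iD le.
  have [le'|gt] := leqP #|diffs y c| r; first by left; rewrite ballC // le' andbF.
  right; rewrite ballC ?subset_diffs_flip // in_diffs_flip eqxx addbT negbK card_diffs_flip iD le.
  rewrite andbT /= eqn_leq le /= -ltnS prednK //.
  exact: leq_ltn_trans (leq0n _) gt.
by left; rewrite ballC // (ltnW le) andbT /= neq_ltn le.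
Qed.

(** * Commutators of two reflections *)

Section Commutator.
Variables (c : cube d) (w : {set 'I_d}) (i j : 'I_d).
Hypotheses (ij : i != j) (iw : i \notin w) (jw : j \notin w).

Definition toggle (a : 'I_d) (b : bool) (x : cube d) := if b then flip a x else x.

Lemma toggleC a b (p q : bool) x : toggle a p (toggle b q x) = toggle b q (toggle a p x).
Proof. by case: p; case: q; rewrite //= flipC. Qed.

Lemma flip_toggle a p x : flip a (toggle a p x) = toggle a (~~ p) x.
Proof. by case: p; rewrite //= flipK. Qed.

(** [p], [q] record the flips of the point and [u], [v] those of the centre, so [pa] and [qb] tell
    whether they now differ at [a] and [b]. The differences elsewhere never change, which reduces
    reflections to Boolean computations. *)
Lemma reflect_toggle a b x (p q u v : bool) : a != b -> a \notin w -> b \notin w ->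
    w \subset diffs x c ->
  let pa := (a \in diffs x c) (+) p (+) u in
  let qb := (b \in diffs x c) (+) q (+) v in
  reflect_on (toggle a u (toggle b v c)) w a (toggle a p (toggle b q x)) =
  toggle a (p (+) ((pa + (qb + #|diffs x c :\: [set a; b]|) == r) && ~~ pa)) (toggle b q x).
Proof.
move=> ab aw bw wx pa qb; rewrite /reflect_on; set D := diffs _ _.
have memD : forall e, (e \in D) =
    (e \in diffs x c) (+) (p (+) u) && (e == a) (+) (q (+) v) && (e == b).
  move=> e.
  rewrite {}/D {}/pa {}/qb /toggle; case: p u q v => [] [] [] [];
    rewrite ?(in_diffs_flip, diffs_flipC) /=;
    by case: (e \in _); case: (e == a); case: (e == b).
have aD : (a \in D) = pa by rewrite memD eqxx (negPf ab) andbF andbT addbF addbA.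
have bD : (b \in D) = qb by rewrite memD eqxx eq_sym (negPf ab) andbF andbT addbF addbA.
have wD : w \subset D.
  apply/subsetP => e ew; rewrite memD (subsetP wx) //.
  have -> : (e == a) = false by apply: contraNF aw => /eqP <-.
  have -> : (e == b) = false by apply: contraNF bw => /eqP <-.
  by rewrite !andbF.
have cardD : #|D| = pa + (qb + #|diffs x c :\: [set a; b]|).
  rewrite (cardsD1 a) aD (cardsD1 b) in_setD1 eq_sym ab bD; congr (_ + (_ + #|pred_of_set _|)).
  apply/setP => e; rewrite !in_setD1 memD in_setD in_set2.
  by case: (e == a); case: (e == b); rewrite ?andbF ?addbF.
rewrite cardD wD aD /=; case: ifP => _; rewrite ?addbF ?addbT //.
exact: flip_toggle.
Qed.

(* The centre of the ball runs through [c], [flip i c], [flip i (flip j c)],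
   [flip j c] and back to [c]. *)
Definition comm_reflect x : cube d :=
  reflect_on (flip j c) w j (reflect_on (flip i (flip j c)) w i
    (reflect_on (flip i c) w j (reflect_on c w i x))).

Lemma comm_reflect_toggle x : w \subset diffs x c ->
  let m := #|diffs x c :\: [set i; j]| in
  let a := i \in diffs x c in let b := j \in diffs x c in
  let p1 := (a + (b + m) == r) && ~~ a in
  let a1 := a (+) p1 (+) true in
  let q1 := (b + (a1 + m) == r) && ~~ b in
  let b1 := b (+) q1 (+) true in
  let p2 := p1 (+) ((a1 + (b1 + m) == r) && ~~ a1) in
  let a2 := a (+) p2 in
  let q2 := q1 (+) ((b1 + (a2 + m) == r) && ~~ b1) in
  comm_reflect x = toggle i p2 (toggle j q2 x).
Proof.
move=> wx m a b p1 a1 q1 b1 p2 a2 q2.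
have ji : j != i by rewrite eq_sym.
have setji : [set j; i] = [set i; j] by rewrite setUC.
have E1 : reflect_on c w i x = toggle i p1 x.
  by have := reflect_toggle false false false false ij iw jw wx; rewrite /= !addbF.
have E2 : reflect_on (flip i c) w j (toggle i p1 x) = toggle j q1 (toggle i p1 x).
  by have := reflect_toggle false p1 false true ji jw iw wx; rewrite /= !addbF setji.
have E3 : reflect_on (flip i (flip j c)) w i (toggle i p1 (toggle j q1 x)) =
    toggle i p2 (toggle j q1 x).
  exact: reflect_toggle p1 q1 true true ij iw jw wx.
have E4 : reflect_on (flip j c) w j (toggle j q1 (toggle i p2 x)) =
    toggle j q2 (toggle i p2 x).
  by have := reflect_toggle q1 p2 true false ji jw iw wx; rewrite /= !addbF setji.
by rewrite /comm_reflect E1 E2 toggleC E3 toggleC E4 toggleC.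
Qed.

Hypothesis card_w : #|w|.+1 = r.

Lemma diffsD_base x : w \subset diffs x c -> #|diffs x c :\: [set i; j]| <= #|w| ->
  diffs x c :\: [set i; j] = w.
Proof.
move=> wx le; apply/esym/eqP; rewrite eqEcard le andbT.
apply/subsetP => e ew; rewrite in_setD in_set2 negb_or (subsetP wx) // andbT.
by rewrite (memPn iw) // (memPn jw).
Qed.

Lemma top_base (a b : bool) m : (a + (b + m) == m.+1) = a (+) b.
Proof.
by case: a; case: b;
  rewrite /= ?add0n ?add1n ?eqSS ?eqxx ?(ltn_eqF (ltnSn m)) ?(gtn_eqF (ltnSn m)).
Qed.

(** In terms of [diffs], this is the 3-cycle from [w] to [w + j] to [w + i] and back to [w]. The
    excluded corner [w + i + j] is at distance [r + 1]. *)
Lemma comm_reflect_base x : w \subset diffs x c -> #|diffs x c :\: [set i; j]| = #|w| ->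
  ~~ ((i \in diffs x c) && (j \in diffs x c)) ->
  comm_reflect x = toggle i ((i \in diffs x c) || (j \in diffs x c))
                  (toggle j (~~ (i \in diffs x c)) x).
Proof.
move=> wx cardm; rewrite comm_reflect_toggle // cardm -card_w !top_base.
by case: (i \in _); case: (j \in _).
Qed.

(** Here [x] agrees with [c] at [i] and [j] and is at distance exactly [r], so it follows the centre
    around the square and returns. *)
Lemma comm_reflect_leaf x : w \subset diffs x c -> #|diffs x c| <= r ->
  #|w| < #|diffs x c :\: [set i; j]| -> comm_reflect x = x.
Proof.
move=> wx le lt; have := cardsD1 i (diffs x c); have := cardsD1 j (diffs x c :\ i).
rewrite in_setD1 eq_sym ij /= setDDl => -> cardD.
have mr : #|diffs x c :\: [set i; j]| = r.
  apply/anti_leq/andP; split; last by rewrite -card_w.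
  by apply: leq_trans le; rewrite cardD addnA leq_addl.
move: le; rewrite comm_reflect_toggle // cardD mr.
case: (i \in _); case: (j \in _); rewrite /= ?add1n ?add0n ?ltnn //.
  by rewrite ltnNge leqnSn.
by rewrite !(add0n, eqxx).
Qed.
End Commutator.

End Moves.

(** * Permutations reached from a ball *)

Section Relabelling.
Variables d k l : nat.
Implicit Types (C D : config d l) (g : {perm label d l}).
Local Open Scope group_scope.

Lemma puz_connect_sym : connect_sym (@puz d l k).
Proof.
by apply: sym_connect_sym => C D; apply/existsP/existsP => -[t /kmove_sym tCD]; exists t.
Qed.

Lemma permute_subproof g C : injectiveb [ffun t => C (g t)].
Proof. by apply/injectiveP => s t; rewrite !ffunE => /config_inj/perm_inj. Qed.

(** Token [t] takes the place of [g t]. This is inverse to the convention of [obtained_by], which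
    does not affect parity. *)
Definition permute g C : config d l := Config (permute_subproof g C).

Lemma permuteE g C t : permute g C t = C (g t).
Proof. by rewrite /= ffunE. Qed.

Lemma config_eqP C D : C =1 D -> C = D.
Proof. by move=> CD; apply/val_inj/ffunP. Qed.

Lemma permute_kmove g C D t : kmove k t C D -> kmove k (g^-1 t) (permute g C) (permute g D).
Proof.
case/existsP => sigma /and5P[fs Cs /forallP emp Ds /forallP fixed].
apply/existsP; exists sigma; rewrite !permuteE permKV fs Cs Ds /=.
apply/andP; split; apply/forallP => v.
  apply/implyP => /(implyP (emp v)); apply: contra => /imsetP[s _ ->].
  by rewrite permuteE imset_f.
apply/implyP => vt; rewrite !permuteE; apply: (implyP (fixed (g v))).
by apply: contraNneq vt => <-; rewrite permK.
Qed.

Lemma permute_connect g C D :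
  connect (puz k) C D -> connect (puz k) (permute g C) (permute g D).
Proof.
case/connectP => p; elim: p C => [|E p IHp] C /=; first by move=> _ ->; exact: connect0.
case/andP => /existsP[t tCE] pE DE; apply: connect_trans (IHp E pE DE).
by apply: connect1; apply/existsP; exists (g^-1 t); apply: permute_kmove.
Qed.

Definition reach_perms C : {set {perm label d l}} := [set g | connect (puz k) C (permute g C)].

(** Moves commute with relabelling, so a path for [h] relabelled by [g] continues a path for [g]. In
    a finite group, closure under products suffices. *)
Lemma reach_perms_group_set C : group_set (reach_perms C).
Proof.
apply/group_setP; split=> [|g h].
  rewrite inE [permute 1 C](_ : _ = C) ?connect0 //.
  by apply: config_eqP => t; rewrite permuteE perm1.
rewrite !inE => Cg Ch; apply: connect_trans Cg _.
have -> : permute (g * h) C = permute g (permute h C).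
  by apply: config_eqP => t; rewrite !permuteE permM.
exact: permute_connect.
Qed.
Canonical reach_group C := Group (reach_perms_group_set C).

Lemma reach_perms_connect C D : connect (puz k) C D -> reach_perms C = reach_perms D.
Proof.
suff sub C' D' : connect (puz k) C' D' -> reach_perms C' \subset reach_perms D'.
  by move=> CD; apply/eqP; rewrite eqEsubset !sub // puz_connect_sym.
move=> CD; apply/subsetP => g; rewrite !inE => Cg.
apply: connect_trans (permute_connect g CD).
by apply: connect_trans Cg; rewrite puz_connect_sym.
Qed.

Lemma even_solvable_reach C :
  (forall g, ~~ odd_perm g -> g \in reach_perms C) -> even_solvable d k l.
Proof.
move=> evenC; apply/existsP; exists C; apply/forallP => g; apply/forallP => D.
apply/implyP => /andP[gE /forallP CD].
have -> : D = permute g^-1 C.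
  by apply: config_eqP => t; rewrite permuteE -(eqP (CD (g^-1 t))) permKV.
by have := evenC g^-1; rewrite inE odd_permV; apply.
Qed.

End Relabelling.

(** * The alternating group on the tokens of a ball *)

Section Ball.
Variables d k l : nat.
Hypotheses (hk : 0 < k) (hkd : k < d).
Implicit Types (C D : config d l) (c : cube d) (A B w : {set 'I_d}).
Local Notation r := (d - k).
Local Notation ball c C := (local_ball k c set0 C).

Lemma ball_local c w C : ball c C -> local_ball k c w C.
Proof. by move=> ballC x _; apply: ballC; exact: sub0set. Qed.

Lemma comm_reflect_config c w i j C : i \notin w -> j \notin w -> local_ball k c w C ->
  exists2 D : config d l, connect (puz k) C D & forall t, D t = comm_reflect k c w i j (C t).
Proof.
move=> iw jw ballC.
have [D1 [C1 E1 B1]] := reflect_config ballC iw.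
have [D2 [C2 E2 B2]] := reflect_config B1 jw.
rewrite flipC in B2.
have [D3 [C3 E3 B3]] := reflect_config B2 iw.
rewrite flipK in B3.
have [D4 [C4 E4 _]] := reflect_config B3 jw.
exists D4; last by move=> t; rewrite E4 E3 E2 E1.
exact: connect_trans C1 (connect_trans C2 (connect_trans C3 C4)).
Qed.

Lemma comm_reflect_out c w i j x : i \notin w -> j \notin w -> ~~ (w \subset diffs x c) ->
  comm_reflect k c w i j x = x.
Proof.
move=> iw jw /negPf nw.
by rewrite /comm_reflect /reflect_on !(diffs_flipC, subset_diffs_flip, nw).
Qed.

Lemma cycle3_reach c w i j C t0 t1 t2 :
    i != j -> i \notin w -> j \notin w -> #|w|.+1 = r -> local_ball k c w C ->
    diffs (C t0) c = w -> C t1 = flip i (C t0) -> C t2 = flip j (C t0) ->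
  cycle3 t0 t2 t1 \in reach_perms k C.
Proof.
move=> ij iw jw cw ballC D0 C1 C2.
have ji : j != i by rewrite eq_sym.
have memF (A B : {set _}) : (forall e, e \notin [set i; j] -> (e \in A) = (e \in B)) ->
    A :\: [set i; j] = B :\: [set i; j].
  by move=> AB; apply/setP => e; rewrite !in_setD; case: (boolP (e \in _)) => // /AB->.
have wD : w :\: [set i; j] = w.
  apply/setDidPl; rewrite disjoint_sym; apply/pred0P => e; rewrite !inE /=.
  case: (e =P i) => [->|_]; first by rewrite (negPf iw) andbF.
  by case: (e =P j) => [->|_]; first by rewrite (negPf jw) andbF.
have memD1 e : (e \in diffs (C t1) c) = (e \in w) (+) (e == i) by rewrite C1 in_diffs_flip D0.
have memD2 e : (e \in diffs (C t2) c) = (e \in w) (+) (e == j) by rewrite C2 in_diffs_flip D0.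
have D1 : diffs (C t1) c :\: [set i; j] = w.
  rewrite -[RHS]wD; apply: memF => e; rewrite memD1 !inE; by case: (e == i); rewrite ?addbF.
have D2 : diffs (C t2) c :\: [set i; j] = w.
  rewrite -[RHS]wD; apply: memF => e; rewrite memD2 !inE orbC.
  by case: (e == j); rewrite ?addbF.
have sub t : diffs (C t) c :\: [set i; j] = w -> w \subset diffs (C t) c.
  by move=> <-; apply: subsetDl.
have [D CD ED] := comm_reflect_config iw jw ballC.
rewrite inE [permute _ _](_ : _ = D) //; apply: config_eqP => t; rewrite permuteE ED permM.
have val s : diffs (C s) c :\: [set i; j] = w ->
    ~~ ((i \in diffs (C s) c) && (j \in diffs (C s) c)) ->
    comm_reflect k c w i j (C s) = toggle i ((i \in diffs (C s) c) || (j \in diffs (C s) c))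
                                  (toggle j (i \notin diffs (C s) c) (C s)).
  by move=> sD; apply: comm_reflect_base; rewrite ?sub ?sD.
have t01 : t0 != t1.
  by apply: contraTneq isT => e; have := memD1 i; rewrite -e D0 eqxx (negPf iw).
have t02 : t0 != t2.
  by apply: contraTneq isT => e; have := memD2 j; rewrite -e D0 eqxx (negPf jw).
have t12 : t1 != t2.
  by apply: contraTneq isT => e; have := memD1 i; rewrite e memD2 eqxx (negPf iw) (negPf ij).
case: (t =P t0) => [->|/eqP tt0].
  by rewrite tpermL tpermD // 1?eq_sym // val ?D0 ?wD ?(negPf iw) ?(negPf jw).
case: (t =P t1) => [->|/eqP tt1].
  rewrite [tperm t0 t2 t1]tpermD // 1?eq_sym // tpermR val ?memD1
    ?(negPf iw) ?(negPf jw) ?eqxx ?(negPf ji) //=.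
  by rewrite C1 flipK.
case: (t =P t2) => [->|/eqP tt2].
  rewrite [tperm t0 t2 t2]tpermR tpermL val ?memD2
    ?(negPf iw) ?(negPf jw) ?eqxx ?(negPf ij) //=.
  by rewrite C2 flipK.
rewrite [tperm t0 t2 t]tpermD 1?eq_sym // tpermD 1?eq_sym //; apply/esym.
have [wt|nwt] := boolP (w \subset diffs (C t) c); last exact: comm_reflect_out.
have le : #|diffs (C t) c| <= r by rewrite -ballC // occupied_token.
have [le_w|lt_w] := leqP #|diffs (C t) c :\: [set i; j]| #|w|; last exact: comm_reflect_leaf.
(* The token [t] lies on the square spanned by the directions [i] and [j] at [C t0]; its corners are
   settled one by one. *)
have Dt : forall e, (e \in diffs (C t) c) = (e \in w) (+) ((i \in diffs (C t) c) && (e == i))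
                                          (+) ((j \in diffs (C t) c) && (e == j)).
  move=> e; have := diffsD_base iw jw wt le_w => /setP/(_ e); rewrite in_setD in_set2.
  case: (e =P i) => [->|_]; first by rewrite (negPf iw) (negPf ij) andbF andbT addbF.
  case: (e =P j) => [->|_]; first by rewrite (negPf jw) andbF andbT.
  by rewrite !andbF !addbF => <-.
have Ct : C t = toggle i (i \in diffs (C t) c) (toggle j (j \in diffs (C t) c) (C t0)).
  apply: (@diffs_inj _ c); apply/setP => e; rewrite Dt.
  by case: (i \in _); case: (j \in _); rewrite /= ?in_diffs_flip D0 ?addbF // addbAC.
move: Ct; case: (boolP (i \in diffs (C t) c)) => it;
  case: (boolP (j \in diffs (C t) c)) => jt /=.
(* The corner opposite [C t0] is at distance [r + 1], hence unoccupied. *)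
- move=> _; move: le; have := cardsD1 i (diffs (C t) c).
  have := cardsD1 j (diffs (C t) c :\ i).
  rewrite in_setD1 ji it jt setDDl (diffsD_base iw jw wt le_w) => -> ->.
  by rewrite -cw !add1n ltnn.
- by rewrite -C1 => /config_inj e; rewrite e eqxx in tt1.
- by rewrite -C2 => /config_inj e; rewrite e eqxx in tt2.
- by move=> /config_inj e; rewrite e eqxx in tt0.
Qed.

Lemma ball_token c C A : ball c C -> #|A| <= r -> exists t, diffs (C t) c = A.
Proof.
move=> ballC leA; pose x : cube d := [ffun i => c i (+) (i \in A)].
have xA : diffs x c = A.
  by apply/setP => i; rewrite !inE !ffunE; case: (c i); case: (i \in A).
have : x \in occupied C by rewrite ballC ?sub0set ?xA.
by case/imsetP => t _ xt; exists t; rewrite -xt.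
Qed.

Lemma subset_of_card (T : finType) (B : {set T}) n : n <= #|B| ->
  exists2 A : {set T}, A \subset B & #|A| = n.
Proof.
move=> leB; have : 0 < #|[set A : {set T} | A \subset B & #|A| == n]|.
  by rewrite cards_draws bin_gt0.
by case/card_gt0P => A; rewrite inE => /andP[AB /eqP An]; exists A.
Qed.

Lemma exists_notin A : #|A| <= r -> exists i, i \notin A.
Proof.
move=> leA; have : 0 < #|~: A|.
  rewrite cardsCs setCK card_ord subn_gt0 (leq_ltn_trans leA) //.
  by rewrite ltn_subrL hk (leq_ltn_trans _ hkd).
by case/card_gt0P => i; rewrite inE => iA; exists i.
Qed.

Lemma ball_cycle3 c C w i : ball c C -> #|w|.+1 = r -> i \notin w ->
  exists t0 t1 t2, [/\ [/\ t0 != t1, t0 != t2 & t1 != t2],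
    cycle3 t0 t1 t2 \in reach_perms k C, diffs (C t0) c = w & diffs (C t1) c = i |: w].
Proof.
move=> ballC cw iw.
(* [i |: w] has [r < d] elements, which leaves a second direction [j]. *)
have [|j] := @exists_notin (i |: w); first by rewrite cardsU1 iw add1n cw.
rewrite in_setU1 negb_or => /andP[ji jw].
have flipD t0 t1 a : a \notin w -> diffs (C t0) c = w -> diffs (C t1) c = a |: w ->
    C t1 = flip a (C t0).
  move=> aw D0 D1; apply: (@diffs_inj _ c); rewrite D1; apply/setP => e.
  by rewrite in_diffs_flip D0 in_setU1; case: eqP => [->|_]; rewrite ?addbF // (negPf aw).
have card1 a : a \notin w -> #|a |: w| <= r by move=> aw; rewrite cardsU1 aw add1n cw.
have [|t0 D0] := ball_token (A := w) ballC; first by rewrite -cw.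
have [t1 D1] := ball_token ballC (card1 i iw).
have [t2 D2] := ball_token ballC (card1 j jw).
have neq a b e : e \notin diffs (C a) c -> e \in diffs (C b) c -> a != b.
  by move=> ea eb; apply: contraNneq ea => ->.
exists t0, t1, t2; split=> //; last first.
  exact: cycle3_reach ji jw iw cw (ball_local (w := w) ballC) D0
    (flipD _ _ _ jw D0 D2) (flipD _ _ _ iw D0 D1).
split.
- by apply: (neq _ _ i); rewrite ?D0 ?D1 ?setU11.
- by apply: (neq _ _ j); rewrite ?D0 ?D2 ?setU11.
- by apply: (neq _ _ j); rewrite ?D1 ?D2 ?setU11 // in_setU1 negb_or ji.
Qed.

(** Inclusion makes the sets of sizes [r - 1] and [r] a connected graph, and the two ends of each
    edge lie in a common 3-cycle. *)
Lemma top_layers_connected (X : {set label d l}) c C : ball c C ->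
    (forall x y z, x != y -> x != z -> y != z -> cycle3 x y z \in reach_perms k C ->
      x \in X -> (y \in X) && (z \in X)) ->
  forall s t, s \in X -> r <= #|diffs (C s) c|.+1 -> r <= #|diffs (C t) c|.+1 -> t \in X.
Proof.
move=> ballC closedX.
pose Y := [set diffs (C t) c | t in X].
have memY t : (diffs (C t) c \in Y) = (t \in X).
  by apply: mem_imset => a b /diffs_inj/config_inj.
have step w i : #|w|.+1 = r -> i \notin w -> (w \in Y) = (i |: w \in Y).
  move=> cw iw.
  have [t0 [t1 [t2 [[t01 t02 t12] cyc <- <-]]]] := ball_cycle3 ballC cw iw.
  rewrite !memY; apply/idP/idP.
    by case/(closedX _ _ _ t01 t02 t12 cyc)/andP.
  have [t10 t20] : t1 != t0 /\ t2 != t0 by rewrite ![_ == t0]eq_sym.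
  rewrite cycle3_rot // in cyc.
  by case/(closedX _ _ _ t12 t10 t20 cyc)/andP.
(* Exchange an element [a] of [A] outside [B] for some [b] of [B] outside [A], passing through
   [A :\ a] of size [r - 1]. *)
have swap A B : #|A| = r -> #|B| = r -> A \in Y -> B \in Y.
  have [n] := ubnP #|A :\: B|; elim: n A => // n IHn A; rewrite ltnS => leAB cA cB AY.
  have [AB|] := boolP (A \subset B).
    suff <- : A = B by []; by apply/eqP; rewrite eqEcard AB cA cB leqnn.
  case/subsetPn => a aA aB.
  have [b bB bA] : exists2 b, b \in B & b \notin A.
    apply/subsetPn; apply: contra aB => BA.
    suff -> : B = A by []; by apply/eqP; rewrite eqEcard BA cA cB leqnn.
  have cAa : #|A :\ a|.+1 = r by move: cA; rewrite (cardsD1 a) aA.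
  have bAa : b \notin A :\ a by rewrite in_setD1 negb_and bA orbT.
  apply: (IHn (b |: A :\ a)) => //.
  - apply: leq_trans leAB; apply: proper_card; apply/properP; split.
      apply/subsetP => e; rewrite !inE => /andP[eB]; rewrite eB.
      by case: eqP => [eb|_ /andP[]//]; rewrite eb bB in eB.
    by exists a; rewrite !inE ?aB ?eqxx ?aA //= ?orbF ?andbT; apply: contraNneq aB => ->.
  - by rewrite cardsU1 bAa add1n.
  - rewrite -step // (step _ a) ?setD1K //.
    by rewrite in_setD1 eqxx.
have top A : #|A| <= r -> r <= #|A|.+1 ->
    exists2 B : {set _}, #|B| = r & (A \in Y) = (B \in Y).
  rewrite leq_eqVlt => /predU1P[rA _|lt le]; first by exists A.
  have [i iA] := exists_notin (ltnW lt).
  have cA : #|A|.+1 = r by apply/anti_leq; rewrite lt le.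
  by exists (i |: A); rewrite ?cardsU1 ?iA // (step _ i).
have leC t : #|diffs (C t) c| <= r by rewrite -ballC ?sub0set // occupied_token.
move=> s t; rewrite -!memY => sY s_top t_top.
have [A cA AE] := top _ (leC s) s_top; have [B cB ->] := top _ (leC t) t_top.
by apply: swap cA cB _; rewrite -AE.
Qed.

Lemma ball_alt_reach c C : ball c C -> forall g, ~~ odd_perm g -> g \in reach_perms k C.
Proof.
move=> ballC.
have [w _ cw] : exists2 w : {set 'I_d}, w \subset setT & #|w| = r.-1.
  apply: subset_of_card; rewrite cardsT card_ord; apply: leq_trans (leq_pred _) (leq_subr _ _).
have cw' : #|w|.+1 = r by rewrite cw prednK // subn_gt0.
have [|i iw] := @exists_notin w; first by rewrite -cw'.
have [t0 [t1 [t2 [[t01 t02 t12] cyc D0 _]]]] := ball_cycle3 ballC cw' iw.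
have [X [t0X altX closedX]] := alt_in_closed t01 t02 t12 cyc.
suff XT : X = setT.
  by move=> g; apply: (alt_inP _ _ altX); rewrite XT; apply/subsetP => x; rewrite inE.
apply/setP => t; rewrite inE.
have topC s : r <= #|diffs (C s) c|.+1 -> s \in X.
  by apply: (top_layers_connected ballC closedX t0X); rewrite D0 cw'.
(* While [t] is too close to the centre to be in the outer layers, move the centre one step away
   from it. [X] must then be shown to contain the outer layers of each new ball. *)
suff reach n D c' : connect (puz k) C D -> ball c' D ->
    (forall s, r <= #|diffs (D s) c'|.+1 -> s \in X) -> r - #|diffs (D t) c'| < n -> t \in X.
  exact: reach (connect0 _ _) ballC topC (ltnSn _).
elim: n D c' => // n IHn D c' CD ballD topD lt_n.
have [/topD //|lt_r] := leqP r #|diffs (D t) c'|.+1.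
have [e eD] := exists_notin (ltnW (ltnW lt_r)).
have [E [DE EE ballE]] := reflect_config ballD (negbT (in_set0 e)).
have CE := connect_trans CD DE.
have EtD : E t = D t by rewrite EE /reflect_on (ltn_eqF (ltnW lt_r)) andbF.
have cardE : #|diffs (E t) (flip e c')| = #|diffs (D t) c'|.+1.
  by rewrite EtD diffs_flipC card_diffs_flip (negPf eD).
apply: (IHn E (flip e c')) => //; last first.
  by rewrite cardE -ltnS; apply: leq_trans lt_n; rewrite ltnS ltn_sub2l // ltnW // ltnW.
(* A token [s] at distance [r] agreeing with the centre at [e] moves along with the centre. It is in
   the outer layers before and after, so it carries membership in [X] over to the new ball. *)
have [B /subsetP Be cB] : exists2 B : {set 'I_d}, B \subset [set~ e] & #|B| = r.
  by apply: subset_of_card; rewrite cardsC1 card_ord -ltnS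
    prednK ?ltn_subrL ?hk (leq_ltn_trans _ hkd).
have eB : e \notin B by apply/negP => /Be; rewrite !inE eqxx.
have [s Ds] : exists s, diffs (D s) c' = B by apply: ball_token; rewrite ?cB.
have sX : s \in X by apply: topD; rewrite Ds cB.
have Es : diffs (E s) (flip e c') = B.
  by rewrite EE /reflect_on Ds sub0set cB eqxx eB diffs_flipC flipK.
move=> u; apply: (top_layers_connected ballE _ sX); last by rewrite Es cB.
by rewrite -(reach_perms_connect CE).
Qed.

Lemma card_ball_lt : #|[set A : {set 'I_d} | #|A| <= r]| < 2 ^ d.
Proof.
rewrite -[d in X in _ < X](card_ord d) -cardsT -card_powerset; apply: proper_card.
apply/properP; split; first by apply/subsetP => A _; rewrite inE subsetT.
exists setT; first by rewrite inE subsetT.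
by rewrite inE cardsT card_ord -ltnNge ltn_subrL hk (leq_ltn_trans _ hkd).
Qed.

Lemma even_solvable_ball :
  l = 2 ^ d - #|[set A : {set 'I_d} | #|A| <= r]| -> even_solvable d k l.
Proof.
set B := [set A | _] => lE.
have cB : 2 ^ d - l = #|B| by rewrite lE subKn // ltnW // card_ball_lt.
pose c : cube d := [ffun _ => false].
pose char (A : {set 'I_d}) : cube d := [ffun i => i \in A].
have charK A : diffs (char A) c = A by apply/setP => i; rewrite inE !ffunE; case: (i \in A).
have C0_inj : injectiveb [ffun t : label d l => char (enum_val (cast_ord cB t))].
  apply/injectiveP => s t; rewrite !ffunE.
  move/(congr1 (fun x : cube d => diffs x c)); rewrite !charK.
  by move/enum_val_inj/cast_ord_inj.
apply: (@even_solvable_reach _ _ _ (Config C0_inj)); apply: (@ball_alt_reach c) => x _.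
apply/imsetP/idP => [[t _ ->]|le].
  by rewrite /= ffunE charK; have := enum_valP (cast_ord cB t); rewrite inE.
have xB : diffs x c \in B by rewrite inE.
exists (cast_ord (esym cB) (enum_rank_in xB (diffs x c))) => //.
rewrite /= ffunE cast_ordKV enum_rankK_in //.
by apply: (@diffs_inj _ c); rewrite charK.
Qed.

End Ball.

(** * The bound on [S_min] and the conclusion *)

Lemma S_min_le d k : 0 < k -> k <= d ->
  S_min d k <= 2 ^ d - #|[set A : {set 'I_d} | #|A| <= d - k]|.
Proof.
move=> hk hkd; rewrite /S_min; case: eqP => [<-|/eqP dk].
  (* For [d = k] the ball is a single point, and the bound equals the conventional value
     [2 ^ k - 1]. *)
  rewrite subnn (_ : [set A : {set 'I_d} | #|A| <= 0] = [set set0]) ?cards1 //.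
  by apply/setP => A; rewrite !inE leqn0 cards_eq0.
have lt_kd : k < d by rewrite ltn_neqAle eq_sym dk.
case: ex_minnP => m _; apply; rewrite /even_solvable_in_range leq_subr andbT subn_gt0.
by rewrite card_ball_lt // even_solvable_ball.
Qed.

Theorem corollary1p10 (d k l : nat) (hk : 1 <= k) (hkd : k <= d)
  (hl : 1 <= l) (hlS : l < S_min d k) :
  forall C : config d l, isolated k C \/ semi_isolated k C.
Proof.
move=> C; apply: isolated_or_semi_isolated.
by have := leq_trans hlS (S_min_le hk hkd); rewrite !ltn_subRL addnC.
Qed.
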